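(* Assume the Python floating-point type is identified with $\mathbb{R}$. For every deterministic hybrid program $\alpha$ (in the fragment det-HP) and all states $\nu,\omega$: if the compiled Python program $\mathrm{Py}(\alpha)$ started in state $\nu$ terminates in state $\omega$, i.e. $(\mathrm{Py}(\alpha),\nu)\rightarrow^*(\bot,\omega)$, then $(\nu,\omega)\in[\![\alpha]\!]$.
   Context: det-HP programs are generated by $\alpha,\beta::= x:=\theta \mid \alpha;\beta \mid (?P;\alpha)\cup(?\neg P;\beta) \mid (?P;\alpha)^*;?\neg P$, where $\theta$ is a term (literals, variables, unary minus, $+,-,\cdot,/$, exponentiation) and $P$ a quantifier-free real-arithmetic formula (comparisons $<,\le,=,\ne,\ge,>$ of terms, $\top,\bot,\neg,\wedge,\vee$). States map variables to reals. Semantics: $(\nu,\omega)\in[\![x:=\theta]\!]$ iff $\omega$ equals $\nu$ except $\omega(x)$ is the value of $\theta$ in $\nu$; $[\![?P]\!]=\{(\nu,\nu):\nu\models P\}$; $;$ is relational composition, $\cup$ union, ${}^*$ reflexive transitive closure. Compilation: $\mathrm{Py}(x:=\theta)=$\texttt{x=}$\mathrm{Py}(\theta)$; $\mathrm{Py}(\alpha;\beta)=\mathrm{Py}(\alpha)$\texttt{;}$\mathrm{Py}(\beta)$; $\mathrm{Py}((?P;\alpha)\cup(?\neg P;\beta))=$\texttt{if} $\mathrm{Py}(P)$\texttt{:} $\mathrm{Py}(\alpha)$ \texttt{else:} $\mathrm{Py}(\beta)$; $\mathrm{Py}((?P;\alpha)^*;?\neg P)=$\texttt{while} $\mathrm{Py}(P)$\texttt{:}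 $\mathrm{Py}(\alpha)$ \texttt{else pass}; terms and formulas compile operator by operator ($+,-,\cdot,/,{}^\wedge\mapsto$ \texttt{+,-,*,/,**}; comparisons to \texttt{<,<=,==,!=,>=,>}; $\top,\bot,\neg,\wedge,\vee\mapsto$ \texttt{True}, \texttt{False}, \texttt{not}, \texttt{and}, \texttt{or}). Python states are stacks mapping variables to reals, identified with the states above; expressions evaluate by the corresponding real and Boolean operations. Small-step semantics of configurations $(s,\nu)$ ($\bot$ denotes the finished program): $(\texttt{x=}e,\nu)\rightarrow(\bot,\nu[x\mapsto u])$ if $e$ evaluates to $u$ in $\nu$; $(\texttt{if } e\texttt{: } s \texttt{ else: } s',\nu)\rightarrow(s,\nu)$ if $e$ evaluates to \texttt{True} and $\rightarrow(s',\nu)$ if to \texttt{False}; $(\texttt{while } e\texttt{: } s\texttt{ else pass},\nu)\rightarrow(s;\texttt{while } e\texttt{: } s\texttt{ else pass},\nu)$ if $e$ evaluates to \texttt{True} and $\rightarrow(\texttt{pass},\nu)$ if to \texttt{False}; $(\texttt{pass},\nu)\rightarrow(\bot,\nu)$; if $(s,\nu)\rightarrow(t,\mu)$ then $(s;s',\nu)\rightarrow(t;s',\mu)$; $(\bot;s',\nu)\rightarrow(s',\nu)$. $\rightarrow^*$ is the reflexive transitive closure. *)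

(* Defs.v *)
From Stdlib Require Import Reals ZArith String Relations.
Open Scope R_scope.

(** Variables of hybrid programs and of Python programs are the same names,
    and both kinds of program act on the same states. *)

Definition var := string.
Definition state := var -> R.

Definition update (nu : state) (x : var) (u : R) : state :=
  fun y => if String.eqb x y then u else nu y.

(** ** Real arithmetic

    Division and exponentiation are partial. Division by zero is undefined.
    [x ^ y] is defined when [x > 0], when [x = 0] and [y >= 0] (with
    [0 ^ 0 = 1]), and when [x < 0] and [y] is an integer.  These are the cases
    in which Python's [**] on floats returns a float. *)

Definition real_div (x y : R) : option R :=
  if Req_dec_T y 0 then None else Some (x / y).

Definition real_pow (x y : R) : option R :=
  if Rlt_dec 0 x then Some (Rpower x y)
  else if Req_dec_T x 0 then
    if Rlt_dec y 0 then None
    else if Req_dec_T y 0 then Some 1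
    else Some 0
  else if Req_dec_T y (IZR (Int_part y)) then Some (powerRZ x (Int_part y))
  else None.

Definition lift2 (f : R -> R -> option R) (a b : option R) : option R :=
  match a, b with
  | Some x, Some y => f x y
  | _, _ => None
  end.

(** ** Terms and quantifier-free formulas *)

Inductive term : Type :=
| TLit (c : R)
| TVar (x : var)
| TNeg (t : term)
| TAdd (t1 t2 : term)
| TSub (t1 t2 : term)
| TMul (t1 t2 : term)
| TDiv (t1 t2 : term)
| TPow (t1 t2 : term).

Inductive formula : Type :=
| FLt (t1 t2 : term)
| FLe (t1 t2 : term)
| FEq (t1 t2 : term)
| FNe (t1 t2 : term)
| FGe (t1 t2 : term)
| FGt (t1 t2 : term)
| FTrue
| FFalse
| FNot (P : formula)
| FAnd (P Q : formula)
| FOr (P Q : formula).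

Fixpoint term_val (nu : state) (t : term) : option R :=
  match t with
  | TLit c => Some c
  | TVar x => Some (nu x)
  | TNeg t => option_map Ropp (term_val nu t)
  | TAdd t1 t2 =>
      lift2 (fun a b => Some (a + b)) (term_val nu t1) (term_val nu t2)
  | TSub t1 t2 =>
      lift2 (fun a b => Some (a - b)) (term_val nu t1) (term_val nu t2)
  | TMul t1 t2 =>
      lift2 (fun a b => Some (a * b)) (term_val nu t1) (term_val nu t2)
  | TDiv t1 t2 => lift2 real_div (term_val nu t1) (term_val nu t2)
  | TPow t1 t2 => lift2 real_pow (term_val nu t1) (term_val nu t2)
  end.

(** Formulas are two-valued: a comparison with an undefined side does not
    hold, and [FNot] is classical negation. *)

Definition cmp_holds (rel : R -> R -> Prop) (nu : state) (t1 t2 : term) : Prop :=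
  exists a b, term_val nu t1 = Some a /\ term_val nu t2 = Some b /\ rel a b.

Fixpoint sat (nu : state) (P : formula) : Prop :=
  match P with
  | FLt t1 t2 => cmp_holds Rlt nu t1 t2
  | FLe t1 t2 => cmp_holds Rle nu t1 t2
  | FEq t1 t2 => cmp_holds eq nu t1 t2
  | FNe t1 t2 => cmp_holds (fun a b => a <> b) nu t1 t2
  | FGe t1 t2 => cmp_holds Rge nu t1 t2
  | FGt t1 t2 => cmp_holds Rgt nu t1 t2
  | FTrue => True
  | FFalse => False
  | FNot P => ~ sat nu P
  | FAnd P Q => sat nu P /\ sat nu Q
  | FOr P Q => sat nu P \/ sat nu Q
  end.

(** ** Hybrid programs without differential equations and nondeterministic
    assignments *)

Inductive hp : Type :=
| HAssign (x : var) (t : term)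
| HTest (P : formula)
| HSeq (a b : hp)
| HChoice (a b : hp)
| HStar (a : hp).

Fixpoint hp_sem (a : hp) : relation state :=
  match a with
  | HAssign x t => fun nu omega =>
      exists u, term_val nu t = Some u
                /\ omega x = u
                /\ forall y, y <> x -> omega y = nu y
  | HTest P => fun nu omega => omega = nu /\ sat nu P
  | HSeq a b => fun nu omega => exists mu, hp_sem a nu mu /\ hp_sem b mu omega
  | HChoice a b => fun nu omega => hp_sem a nu omega \/ hp_sem b nu omega
  | HStar a => clos_refl_trans state (hp_sem a)
  end.

(** The deterministic fragment is given by its grammar; [hp_of_det] writes out
    the guarded choice and the guarded loop as hybrid programs. *)

Inductive det_hp : Type :=
| DAssign (x : var) (t : term)
| DSeq (a b : det_hp)
| DIf (P : formula) (a b : det_hp)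
| DWhile (P : formula) (a : det_hp).

Fixpoint hp_of_det (a : det_hp) : hp :=
  match a with
  | DAssign x t => HAssign x t
  | DSeq a b => HSeq (hp_of_det a) (hp_of_det b)
  | DIf P a b =>
      HChoice (HSeq (HTest P) (hp_of_det a))
              (HSeq (HTest (FNot P)) (hp_of_det b))
  | DWhile P a =>
      HSeq (HStar (HSeq (HTest P) (hp_of_det a))) (HTest (FNot P))
  end.

(** ** Python *)

Inductive py_binop : Type := PyAdd | PySub | PyMul | PyDiv | PyPow.

Inductive py_cmpop : Type := PyLt | PyLe | PyEq | PyNe | PyGe | PyGt.

Inductive py_expr : Type :=
| PyLit (c : R)
| PyVar (x : var)
| PyNeg (e : py_expr)
| PyBin (op : py_binop) (e1 e2 : py_expr)
| PyCmp (op : py_cmpop) (e1 e2 : py_expr)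
| PyTrue
| PyFalse
| PyNot (e : py_expr)
| PyAnd (e1 e2 : py_expr)
| PyOr (e1 e2 : py_expr).

(** The floating-point type is identified with [R]. *)

Inductive py_value : Type :=
| VFloat (r : R)
| VBool (b : bool).

Definition py_binop_val (op : py_binop) (a b : R) : option R :=
  match op with
  | PyAdd => Some (a + b)
  | PySub => Some (a - b)
  | PyMul => Some (a * b)
  | PyDiv => real_div a b
  | PyPow => real_pow a b
  end.

Definition py_cmpop_val (op : py_cmpop) (a b : R) : bool :=
  match op with
  | PyLt => if Rlt_dec a b then true else false
  | PyLe => if Rle_dec a b then true else false
  | PyEq => if Req_dec_T a b then true else false
  | PyNe => if Req_dec_T a b then false else true
  | PyGe => if Rge_dec a b then true else false
  | PyGt => if Rgt_dec a b then true else false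
  end.

(** [None] stands for a raised exception or an ill-typed expression.  As in
    Python, [and] and [or] evaluate their right operand only when needed. *)

Fixpoint py_eval (nu : state) (e : py_expr) : option py_value :=
  match e with
  | PyLit c => Some (VFloat c)
  | PyVar x => Some (VFloat (nu x))
  | PyNeg e =>
      match py_eval nu e with
      | Some (VFloat a) => Some (VFloat (- a))
      | _ => None
      end
  | PyBin op e1 e2 =>
      match py_eval nu e1, py_eval nu e2 with
      | Some (VFloat a), Some (VFloat b) =>
          option_map VFloat (py_binop_val op a b)
      | _, _ => None
      end
  | PyCmp op e1 e2 =>
      match py_eval nu e1, py_eval nu e2 with
      | Some (VFloat a), Some (VFloat b) => Some (VBool (py_cmpop_val op a b))
      | _, _ => None
      end
  | PyTrue => Some (VBool true)
  | PyFalse => Some (VBool false)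
  | PyNot e =>
      match py_eval nu e with
      | Some (VBool b) => Some (VBool (negb b))
      | _ => None
      end
  | PyAnd e1 e2 =>
      match py_eval nu e1 with
      | Some (VBool false) => Some (VBool false)
      | Some (VBool true) =>
          match py_eval nu e2 with
          | Some (VBool b) => Some (VBool b)
          | _ => None
          end
      | _ => None
      end
  | PyOr e1 e2 =>
      match py_eval nu e1 with
      | Some (VBool true) => Some (VBool true)
      | Some (VBool false) =>
          match py_eval nu e2 with
          | Some (VBool b) => Some (VBool b)
          | _ => None
          end
      | _ => None
      end
  end.

(** [PyDone] is the finished program, written [⊥] on paper; it occurs only at
    run time.  [PyWhile e s] is [while e: s else pass]. *)

Inductive py_stmt : Type :=
| PyDone
| PyPass
| PyAssign (x : var) (e : py_expr)
| PySeq (s1 s2 : py_stmt)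
| PyIf (e : py_expr) (s1 s2 : py_stmt)
| PyWhile (e : py_expr) (s : py_stmt).

Definition config : Type := py_stmt * state.

Inductive py_step : config -> config -> Prop :=
| step_assign x e nu u :
    py_eval nu e = Some (VFloat u) ->
    py_step (PyAssign x e, nu) (PyDone, update nu x u)
| step_if_true e s1 s2 nu :
    py_eval nu e = Some (VBool true) ->
    py_step (PyIf e s1 s2, nu) (s1, nu)
| step_if_false e s1 s2 nu :
    py_eval nu e = Some (VBool false) ->
    py_step (PyIf e s1 s2, nu) (s2, nu)
| step_while_true e s nu :
    py_eval nu e = Some (VBool true) ->
    py_step (PyWhile e s, nu) (PySeq s (PyWhile e s), nu)
| step_while_false e s nu :
    py_eval nu e = Some (VBool false) ->
    py_step (PyWhile e s, nu) (PyPass, nu)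
| step_pass nu :
    py_step (PyPass, nu) (PyDone, nu)
| step_seq s t s' nu mu :
    py_step (s, nu) (t, mu) ->
    py_step (PySeq s s', nu) (PySeq t s', mu)
| step_seq_done s' nu :
    py_step (PySeq PyDone s', nu) (s', nu).

Definition py_steps : config -> config -> Prop := clos_refl_trans config py_step.

(** ** Compilation *)

Fixpoint py_of_term (t : term) : py_expr :=
  match t with
  | TLit c => PyLit c
  | TVar x => PyVar x
  | TNeg t => PyNeg (py_of_term t)
  | TAdd t1 t2 => PyBin PyAdd (py_of_term t1) (py_of_term t2)
  | TSub t1 t2 => PyBin PySub (py_of_term t1) (py_of_term t2)
  | TMul t1 t2 => PyBin PyMul (py_of_term t1) (py_of_term t2)
  | TDiv t1 t2 => PyBin PyDiv (py_of_term t1) (py_of_term t2)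
  | TPow t1 t2 => PyBin PyPow (py_of_term t1) (py_of_term t2)
  end.

Fixpoint py_of_formula (P : formula) : py_expr :=
  match P with
  | FLt t1 t2 => PyCmp PyLt (py_of_term t1) (py_of_term t2)
  | FLe t1 t2 => PyCmp PyLe (py_of_term t1) (py_of_term t2)
  | FEq t1 t2 => PyCmp PyEq (py_of_term t1) (py_of_term t2)
  | FNe t1 t2 => PyCmp PyNe (py_of_term t1) (py_of_term t2)
  | FGe t1 t2 => PyCmp PyGe (py_of_term t1) (py_of_term t2)
  | FGt t1 t2 => PyCmp PyGt (py_of_term t1) (py_of_term t2)
  | FTrue => PyTrue
  | FFalse => PyFalse
  | FNot P => PyNot (py_of_formula P)
  | FAnd P Q => PyAnd (py_of_formula P) (py_of_formula Q)
  | FOr P Q => PyOr (py_of_formula P) (py_of_formula Q)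
  end.

Fixpoint Py (a : det_hp) : py_stmt :=
  match a with
  | DAssign x t => PyAssign x (py_of_term t)
  | DSeq a b => PySeq (Py a) (Py b)
  | DIf P a b => PyIf (py_of_formula P) (Py a) (Py b)
  | DWhile P a => PyWhile (py_of_formula P) (Py a)
  end.

(* Main.v *)
(** The small-step semantics is contained in a big-step one, because
    prefixing a step to a terminating evaluation gives a terminating
    evaluation.  The big-step semantics is compared with the relational one by
    induction on the program, with an inner induction on the evaluation for
    loops.  An undefined term leaves the Python program stuck, so in a
    terminating run every evaluated guard has a Boolean value, which is the
    truth value of the formula. *)
Require Import Defs.
From Stdlib Require Import Reals String Relations.

(** [PyDone] has a rule of its own because runs are also needed from intermediate configurations
    such as [PySeq PyDone s']. *)
Inductive py_run : py_stmt -> state -> state -> Prop :=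
| run_done nu : py_run PyDone nu nu
| run_pass nu : py_run PyPass nu nu
| run_assign x e nu u :
    py_eval nu e = Some (VFloat u) ->
    py_run (PyAssign x e) nu (update nu x u)
| run_seq s1 s2 nu mu omega :
    py_run s1 nu mu -> py_run s2 mu omega ->
    py_run (PySeq s1 s2) nu omega
| run_if_true e s1 s2 nu omega :
    py_eval nu e = Some (VBool true) -> py_run s1 nu omega ->
    py_run (PyIf e s1 s2) nu omega
| run_if_false e s1 s2 nu omega :
    py_eval nu e = Some (VBool false) -> py_run s2 nu omega ->
    py_run (PyIf e s1 s2) nu omega
| run_while_true e s nu mu omega :
    py_eval nu e = Some (VBool true) ->
    py_run s nu mu -> py_run (PyWhile e s) mu omega ->
    py_run (PyWhile e s) nu omega
| run_while_false e s nu :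
    py_eval nu e = Some (VBool false) ->
    py_run (PyWhile e s) nu nu.

Lemma py_step_run (c d : config) (omega : state) :
  py_step c d -> py_run (fst d) (snd d) omega -> py_run (fst c) (snd c) omega.
Proof.
  (* For a step inside [PySeq], the induction hypothesis is used at the state between the two
     statements, so the final state must be general. *)
  intros Hstep; revert omega.
  induction Hstep; simpl in *; intros omega Hrun.
  - inversion Hrun; subst; now constructor.
  - now apply run_if_true.
  - now apply run_if_false.
  - inversion Hrun; subst; eapply run_while_true; eassumption.
  - inversion Hrun; subst; now apply run_while_false.
  - inversion Hrun; subst; constructor.
  - inversion Hrun; subst; eapply run_seq; eauto.
  - eapply run_seq; [constructor | exact Hrun].
Qed.

Lemma py_steps_run (s : py_stmt) (nu omega : state) :
  py_steps (s, nu) (PyDone, omega) -> py_run s nu omega.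
Proof.
  (* This form of the closure peels off the first step, which is what [py_step_run] prefixes. *)
  intros Hsteps; apply clos_rt_rt1n in Hsteps.
  change (py_run (fst (s, nu)) (snd (s, nu)) omega).
  remember (PyDone, omega) as d eqn:Hd.
  induction Hsteps; subst.
  - constructor.
  - eapply py_step_run; eauto.
Qed.

(** Both evaluators apply the same partial operations, so they also agree on undefinedness. *)
Lemma py_eval_term (nu : state) (t : term) :
  py_eval nu (py_of_term t) = option_map VFloat (term_val nu t).
Proof.
  induction t; simpl; rewrite ?IHt, ?IHt1, ?IHt2; try reflexivity;
    try (destruct (term_val nu t); reflexivity);
    destruct (term_val nu t1), (term_val nu t2); reflexivity.
Qed.

Definition cmp_rel (op : py_cmpop) : R -> R -> Prop :=
  match op with
  | PyLt => Rlt
  | PyLe => Rle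
  | PyEq => eq
  | PyNe => fun a b => a <> b
  | PyGe => Rge
  | PyGt => Rgt
  end.

Lemma py_cmpop_val_spec (op : py_cmpop) (a b : R) :
  py_cmpop_val op a b = true <-> cmp_rel op a b.
Proof.
  destruct op; simpl;
    match goal with |- context [if ?d then _ else _] => destruct d end;
    intuition congruence.
Qed.

Lemma py_eval_cmp (nu : state) (op : py_cmpop) (t1 t2 : term) (v : py_value) :
  py_eval nu (PyCmp op (py_of_term t1) (py_of_term t2)) = Some v ->
  exists b, v = VBool b /\ (b = true <-> cmp_holds (cmp_rel op) nu t1 t2).
Proof.
  simpl; rewrite !py_eval_term; unfold cmp_holds.
  destruct (term_val nu t1) as [a1|], (term_val nu t2) as [a2|]; simpl;
    try discriminate.
  intros [= <-]; eexists; split; [reflexivity|].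
  rewrite py_cmpop_val_spec; split.
  - intros Hrel; now exists a1, a2.
  - now intros (b1 & b2 & [= <-] & [= <-] & Hrel).
Qed.

(** Success of the evaluation has to be assumed: [sat] gives a truth value even to comparisons on
    which Python gets stuck. *)
Lemma py_eval_formula (nu : state) (P : formula) (v : py_value) :
  py_eval nu (py_of_formula P) = Some v ->
  exists b, v = VBool b /\ (b = true <-> sat nu P).
Proof.
  revert v; induction P; intros v Hv; try exact (py_eval_cmp _ _ _ _ _ Hv);
    simpl in *.
  - injection Hv as <-; exists true; tauto.
  - injection Hv as <-; exists false; intuition congruence.
  - destruct (py_eval nu (py_of_formula P)) as [w|]; [|discriminate].
    destruct (IHP w eq_refl) as (b & -> & Hb).
    injection Hv as <-; exists (negb b); split; [reflexivity|].
    destruct b; simpl; intuition congruence.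
  - destruct (py_eval nu (py_of_formula P1)) as [w|]; [|discriminate].
    destruct (IHP1 w eq_refl) as (b & -> & Hb).
    destruct b.
    + destruct (py_eval nu (py_of_formula P2)) as [w|]; [|discriminate].
      destruct (IHP2 w eq_refl) as (b & -> & Hb').
      injection Hv as <-; exists b; tauto.
    (* Short circuit: the right operand may be undefined, but the left one already refutes the
       conjunction. *)
    + injection Hv as <-; exists false; intuition congruence.
  - destruct (py_eval nu (py_of_formula P1)) as [w|]; [|discriminate].
    destruct (IHP1 w eq_refl) as (b & -> & Hb).
    destruct b.
    (* Dually, a true left operand settles the disjunction. *)
    + injection Hv as <-; exists true; tauto.
    + destruct (py_eval nu (py_of_formula P2)) as [w|]; [|discriminate].
      destruct (IHP2 w eq_refl) as (b & -> & Hb').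
      injection Hv as <-; exists b; intuition congruence.
Qed.

Lemma py_eval_formula_true (nu : state) (P : formula) :
  py_eval nu (py_of_formula P) = Some (VBool true) -> sat nu P.
Proof.
  intros H; destruct (py_eval_formula _ _ _ H) as (b & [= <-] & Hb); tauto.
Qed.

Lemma py_eval_formula_false (nu : state) (P : formula) :
  py_eval nu (py_of_formula P) = Some (VBool false) -> ~ sat nu P.
Proof.
  intros H; destruct (py_eval_formula _ _ _ H) as (b & [= <-] & Hb).
  intuition congruence.
Qed.

(** Each iteration contributes one guarded step, and the run ends where the guard is false. An
    abstract [r] separates this induction on the run from the one on programs. *)
Lemma py_run_while (P : formula) (s : py_stmt) (r : relation state)
    (nu omega : state) :
  (forall mu mu', py_run s mu mu' -> r mu mu') ->
  py_run (PyWhile (py_of_formula P) s) nu omega ->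
  clos_refl_trans state (fun mu mu' => sat mu P /\ r mu mu') nu omega
  /\ ~ sat omega P.
Proof.
  intros Hbody Hrun.
  remember (PyWhile (py_of_formula P) s) as w eqn:Hw.
  induction Hrun; try discriminate; injection Hw as -> ->.
  - destruct IHHrun2 as [Hstar Hexit]; [reflexivity|].
    split; [|exact Hexit].
    eapply rt_trans; [apply rt_step | exact Hstar].
    split; [now apply py_eval_formula_true | now apply Hbody].
  - split; [apply rt_refl | now apply py_eval_formula_false].
Qed.

Lemma py_run_sound (alpha : det_hp) (nu omega : state) :
  py_run (Py alpha) nu omega -> hp_sem (hp_of_det alpha) nu omega.
Proof.
  revert nu omega.
  induction alpha as [x t | a IHa b IHb | P a IHa b IHb | P a IHa];
    intros nu omega Hrun; simpl in *.
  - inversion Hrun as [| | x' e' nu' u Hu | | | | |]; subst.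
    rewrite py_eval_term in Hu.
    destruct (term_val nu t) as [r|]; [injection Hu as -> | discriminate].
    exists u; unfold update; repeat split.
    + now rewrite String.eqb_refl.
    + intros y Hy; destruct (String.eqb_spec x y); congruence.
  - inversion Hrun; subst; eauto.
  (* A test leaves the state unchanged, so the branch starts in [nu]. *)
  - inversion Hrun; subst; [left | right]; exists nu;
      auto using py_eval_formula_true, py_eval_formula_false.
  - apply (py_run_while P (Py a) (hp_sem (hp_of_det a))) in Hrun; [|exact IHa].
    destruct Hrun as [Hstar Hexit].
    exists omega; split; [|now split].
    (* Each guarded step is turned into the composition of the test with the body, through the
       intermediate state [mu]. *)
    clear Hexit; induction Hstar as [mu mu' [Hsat Hmu] | |].
    + apply rt_step; exists mu; auto.
    + apply rt_refl.
    + eapply rt_trans; eassumption.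
Qed.

Theorem theorem6 (alpha : det_hp) (nu omega : state) :
  py_steps (Py alpha, nu) (PyDone, omega) ->
  hp_sem (hp_of_det alpha) nu omega.
Proof.
  intros Hsteps; apply py_run_sound, py_steps_run, Hsteps.
Qed.
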